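(* Let $K$ be a vertex-homogeneous finite simplicial complex. Then the core of $K$ is vertex-homogeneous and it is isomorphic to $\mathcal{N}^2(K)$.
   Context: All simplicial complexes are finite (simplices are nonempty finite sets of vertices). A complex $K$ is vertex-homogeneous if for any two vertices $v,w\in K$ there is a simplicial automorphism $\varphi:K\to K$ with $\varphi(v)=w$. For a vertex $v$ of a complex $K$, the link $\mathrm{lk}_K(v)$ is the subcomplex of simplices $\tau\in K$ with $v\notin\tau$ and $\tau\cup\{v\}\in K$, and $K\smallsetminus v$ is the full subcomplex of $K$ spanned by the vertices different from $v$. A simplicial cone is a complex $aM$, the join of a (possibly empty) complex $M$ and a vertex $a$ not in $M$; its simplices are $\{a\}$, the simplices $\tau$ of $M$, and the sets $\{a\}\cup\tau$ with $\tau\in M$. A vertex $v$ of $K$ is dominated if $\mathrm{lk}_K(v)$ is a simplicial cone; in that case there is an elementary strong collapse from $K$ to $K\smallsetminus v$. A strong collapse from $K$ to a subcomplex $L$ is a finite (possibly empty) sequence of elementary strong collapses starting in $K$ and ending in $L$. A complex is minimal if it has no dominated vertices. A core of $K$ is a subcomplex $K_0\subseteq K$ which is a minimal complex and such that $K$ strong collapses to $K_0$; every complex has a core and it is unique up to isomorphism, so one speaks of the core of $K$. The nerve $\mathcal{N}(K)$ of a complex $K$ is the complex whose vertices are the maximal simplices of $K$ and whose simplices are the (nonempty) sets of maximal simplices of $K$ with nonempty intersection; $\mathcal{N}^2(K)=\mathcal{N}(\mathcal{N}(K))$. *)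

(* Defs.v *)
From HB Require Import structures.
From mathcomp Require Import all_boot.

Set Implicit Arguments.
Unset Strict Implicit.
Unset Printing Implicit Defensive.

(* A complex over V need not use every point of V as a vertex, so that a      *)
(* complex and its subcomplexes live over the same type V. The empty complex  *)
(* is allowed; the empty set is never a simplex.                              *)
Definition complex_axiom (V : finType) (S : {set {set V}}) : bool :=
  (set0 \notin S) &&
  [forall s in S, forall t : {set V}, (t \subset s) && (t != set0) ==> (t \in S)].

Record complex (V : finType) : Type := Complex {
  simplices :> {set {set V}};
  complexP : complex_axiom simplices
}.

HB.instance Definition _ (V : finType) := [isSub for @simplices V].
HB.instance Definition _ (V : finType) := [Finite of complex V by <:].

Lemma complex_axiomP (V : finType) (S : {set {set V}}) :
  reflect ((forall s, s \in S -> s != set0) /\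
           (forall s t : {set V}, s \in S -> t \subset s -> t != set0 -> t \in S))
          (complex_axiom S).
Proof.
apply: (iffP andP) => [[S0 Sd]|[S0 Sd]]; split.
- by move=> s sS; apply: contraNneq S0 => <-.
- move=> s t sS ts t0; move/forall_inP: Sd => /(_ s sS) /forallP/(_ t).
  by rewrite ts t0.
- by apply/negP => /S0; rewrite eqxx.
- apply/forall_inP => s sS; apply/forallP => t; apply/implyP => /andP[ts t0].
  exact: Sd sS ts t0.
Qed.

Lemma simplex_neq0 (V : finType) (K : complex V) s : s \in simplices K -> s != set0.
Proof. by case/complex_axiomP: (complexP K) => + _; apply. Qed.

Lemma simplex_sub (V : finType) (K : complex V) (s t : {set V}) :
  s \in simplices K -> t \subset s -> t != set0 -> t \in simplices K.
Proof. by case/complex_axiomP: (complexP K) => _; apply. Qed.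

Definition vertices (V : finType) (K : complex V) : {set V} :=
  [set v | [set v] \in simplices K].

Definition vertex (V : finType) (K : complex V) : finType :=
  {v : V | v \in vertices K}.

Definition simplicial (V W : finType) (K : complex V) (L : complex W)
    (f : vertex K -> vertex L) : Prop :=
  forall s : {set vertex K}, [set val x | x in s] \in simplices K ->
    [set val (f x) | x in s] \in simplices L.

Definition simplicial_iso (V W : finType) (K : complex V) (L : complex W)
    (f : vertex K -> vertex L) : Prop :=
  simplicial f /\
  exists g : vertex L -> vertex K, [/\ simplicial g, cancel f g & cancel g f].

Definition isomorphic (V W : finType) (K : complex V) (L : complex W) : Prop :=
  exists f : vertex K -> vertex L, simplicial_iso f.

Definition vertex_homogeneous (V : finType) (K : complex V) : Prop :=
  forall v w : vertex K, exists2 f : vertex K -> vertex K,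
    simplicial_iso f & f v = w.

Definition link_simplices (V : finType) (K : complex V) (v : V) : {set {set V}} :=
  [set t in simplices K | (v \notin t) && (v |: t \in simplices K)].

Lemma link_complex (V : finType) (K : complex V) (v : V) :
  complex_axiom (link_simplices K v).
Proof.
apply/complex_axiomP; split=> [s|s t].
  by rewrite inE => /andP[/simplex_neq0].
rewrite !inE => /and3P[sK vs vsK] ts t0.
rewrite (simplex_sub sK ts t0) (contra (subsetP ts v) vs) /=.
apply: (simplex_sub vsK); first exact: setUS.
by apply/set0Pn; exists v; apply: setU11.
Qed.

Definition link (V : finType) (K : complex V) (v : V) : complex V :=
  Complex (link_complex K v).

Definition full_simplices (V : finType) (K : complex V) (A : {set V}) : {set {set V}} :=
  [set s in simplices K | s \subset A].

Lemma full_complex (V : finType) (K : complex V) (A : {set V}) :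
  complex_axiom (full_simplices K A).
Proof.
apply/complex_axiomP; split=> [s|s t].
  by rewrite inE => /andP[/simplex_neq0].
rewrite !inE => /andP[sK sA] ts t0.
by rewrite (simplex_sub sK) // (subset_trans ts).
Qed.

Definition full_subcomplex (V : finType) (K : complex V) (A : {set V}) : complex V :=
  Complex (full_complex K A).

Definition deletion (V : finType) (K : complex V) (v : V) : complex V :=
  full_subcomplex K (vertices K :\ v).

Definition cone_simplices (V : finType) (a : V) (M : complex V) : {set {set V}} :=
  [set a] |: (simplices M :|: [set a |: t | t in simplices M]).

Lemma cone_complex (V : finType) (a : V) (M : complex V) :
  complex_axiom (cone_simplices a M).
Proof.
apply/complex_axiomP; split=> [s|s t].
  rewrite !inE => /or3P[/eqP->|/simplex_neq0//|/imsetP[t _ ->]].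
    by apply/set0Pn; exists a; rewrite inE.
  by apply/set0Pn; exists a; rewrite !inE eqxx.
have key (u : {set V}) : u :\ a = set0 \/ u :\ a \in simplices M ->
    u != set0 -> u \in cone_simplices a M.
  move=> ua u0; have [au|au] := boolP (a \in u).
    rewrite !inE -(setD1K au); case: ua => [->|uM]; first by rewrite setU0 eqxx.
    by rewrite [X in [|| _, _ | X]]imset_f ?orbT.
  have <- : u :\ a = u by apply/setDidPl; rewrite disjoint_sym disjoints1.
  case: ua => [ua|uM]; last by rewrite !inE uM orbT.
  case/negP: u0; rewrite -ua; apply/eqP/esym/setDidPl.
  by rewrite disjoint_sym disjoints1.
move=> sC ts t0; apply: key => //.
have [->|ta0] := eqVneq (t :\ a) set0; [by left | right].
have subM u : u \in simplices M -> t :\ a \subset u -> t :\ a \in simplices M.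
  by move=> uM tu; apply: simplex_sub uM tu ta0.
move: sC; rewrite !inE => /or3P[/eqP sa|sM|/imsetP[u uM su]].
- case/negP: ta0; rewrite -subset0; apply/subsetP => x; rewrite !inE.
  by case/andP=> xa /(subsetP ts); rewrite sa inE (negPf xa).
- by apply: (subM s) => //; apply: subset_trans ts; apply: subsetDl.
- apply: (subM u) => //; apply/subsetP => x; rewrite !inE => /andP[xa].
  by move/(subsetP ts); rewrite su !inE (negPf xa).
Qed.

Definition cone (V : finType) (a : V) (M : complex V) : complex V :=
  Complex (cone_complex a M).

Definition is_cone (V : finType) (L : complex V) : Prop :=
  exists (a : V) (M : complex V), a \notin vertices M /\ L = cone a M.

Definition dominated (V : finType) (K : complex V) (v : V) : Prop :=
  v \in vertices K /\ is_cone (link K v).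

Inductive strong_collapse (V : finType) : complex V -> complex V -> Prop :=
| strong_collapse_refl K : strong_collapse K K
| strong_collapse_step K L v :
    dominated K v -> strong_collapse (deletion K v) L -> strong_collapse K L.

Definition minimal (V : finType) (K : complex V) : Prop :=
  forall v : V, ~ dominated K v.

Definition is_core (V : finType) (K K0 : complex V) : Prop :=
  [/\ simplices K0 \subset simplices K, minimal K0 & strong_collapse K K0].

Lemma core_exists (V : finType) (K : complex V) : exists K0, is_core K K0.
Proof.
have [n] := ubnP #|simplices K|; elim: n K => // n IHn K; rewrite ltnS => Kn.
pose dom v := (v \in vertices K) && [exists a : V, [exists M : complex V,
  (a \notin vertices M) && (link K v == cone a M)]].
have domP v : reflect (dominated K v) (dom v).
  apply: (iffP andP) => -[vK].
    by case/existsP=> a /existsP[M /andP[aM /eqP e]]; split=> //; exists a, M.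
  case=> a [M [aM e]]; split=> //; apply/existsP; exists a; apply/existsP; exists M.
  by rewrite aM e eqxx.
have [/existsP[v /domP dv]|/existsPn nd] := boolP [exists v, dom v]; last first.
  exists K; split; first exact: subxx; last exact: strong_collapse_refl.
  by move=> v /domP; apply/negP.
have sub : simplices (deletion K v) \subset simplices K.
  by apply/subsetP => s; rewrite inE => /andP[].
case: (IHn (deletion K v)) => [|K0 [K0sub K0min K0c]].
  apply: leq_trans Kn; apply: proper_card; apply/properP; split=> //.
  exists [set v]; first by case: dv; rewrite inE.
  by rewrite inE sub1set !inE eqxx andbF.
exists K0; split=> //; first exact: subset_trans sub.
exact: strong_collapse_step dv K0c.
Qed.

Definition maximal_simplices (V : finType) (K : complex V) : {set {set V}} :=
  [set s | maxset (fun t => t \in simplices K) s].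

(* The condition S != set0 is not implied by the last one, since the          *)
(* intersection of the empty family is the whole of V.                        *)
Definition nerve_simplices (V : finType) (K : complex V) : {set {set {set V}}} :=
  [set S : {set {set V}} | [&& S != set0, S \subset maximal_simplices K
                             & \bigcap_(s in S) s != set0]].

Lemma nerve_complex (V : finType) (K : complex V) :
  complex_axiom (nerve_simplices K).
Proof.
apply/complex_axiomP; split=> [S|S T]; rewrite !inE; first by case/and3P.
case/and3P=> _ SK /set0Pn[x /bigcapP xS] TS ->.
rewrite (subset_trans TS) //=; apply/set0Pn; exists x; apply/bigcapP => s sT.
by apply: xS; apply: (subsetP TS).
Qed.

Definition nerve (V : finType) (K : complex V) : complex {set V} :=
  Complex (nerve_complex K).

(* Main.v *)
Require Import Defs.
From mathcomp Require Import all_boot.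

(* Call v below w when every simplex containing v can be enlarged by w; this   *)
(* is inclusion of the sets of maximal simplices through v and w, and a vertex *)
(* is dominated iff it is below another vertex. In a vertex-homogeneous        *)
(* complex an automorphism moving v to w embeds the set of vertices above v    *)
(* into the set of those above w, so the preorder is an equivalence relation.  *)
(* A strong collapse then only removes a vertex which has another              *)
(* representative of its class, and a core is the full subcomplex on a         *)
(* transversal of the classes. The retraction onto the transversal transports  *)
(* automorphisms of K to the core. The second nerve is the same transversal in *)
(* disguise: the maximal simplices of the nerve are exactly the sets of        *)
(* maximal simplices through a given vertex.                                   *)

Set Implicit Arguments.
Unset Strict Implicit.
Unset Printing Implicit Defensive.

(** Homogeneity enters through [below_sym], which turns domination into an equivalence of vertices.
    By [dominatedP] a strong collapse discards only vertices with another vertex above them, so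
    [meets_classes] survives collapses, and minimality leaves one vertex per class
    ([core_below_inj]). Homogeneity of the core and the description of the second nerve
    ([maximal_nerveP]) both follow from this. *)

Lemma mem_vertices (V : finType) (K : complex V) s x :
  s \in simplices K -> x \in s -> x \in vertices K.
Proof.
move=> sK xs; rewrite inE; apply: simplex_sub sK _ _; first by rewrite sub1set.
by apply/set0Pn; exists x; rewrite inE.
Qed.

Lemma val_imsetE (V : finType) (K : complex V) (s : {set V}) :
  s \subset vertices K -> exists t : {set vertex K}, s = [set val x | x in t].
Proof.
move=> sK; exists [set x | val x \in s]; apply/setP => x.
apply/idP/imsetP => [xs|[y + ->]]; last by rewrite inE.
have xK := subsetP sK _ xs.
by exists (Sub x xK : vertex K); rewrite ?inE SubK.
Qed.

(** * Maps on vertex types versus maps on ambient types *)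

Section TotalMaps.
Variables (V W : finType) (K : complex V) (L : complex W).

Lemma total_maps_iso (f : V -> W) (g : W -> V) :
    (forall s, s \in simplices K -> f @: s \in simplices L) ->
    (forall s, s \in simplices L -> g @: s \in simplices K) ->
    {in vertices K, cancel f g} -> {in vertices L, cancel g f} ->
  exists2 F : vertex K -> vertex L,
    simplicial_iso F & forall x, val (F x) = f (val x).
Proof.
move=> fK gL fg gf.
have fv (x : vertex K) : f (val x) \in vertices L.
  by rewrite inE -imset_set1 fK //; have := valP x; rewrite inE.
have gv (x : vertex L) : g (val x) \in vertices K.
  by rewrite inE -imset_set1 gL //; have := valP x; rewrite inE.
pose F (x : vertex K) : vertex L := Sub (f (val x)) (fv x).
pose G (x : vertex L) : vertex K := Sub (g (val x)) (gv x).
exists F => [|x]; last by rewrite SubK.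
split=> [s /fK|]; first by rewrite -imset_comp.
exists G; split=> [s /gL|x|x]; first by rewrite -imset_comp.
- by apply: val_inj; rewrite /G !SubK fg //; apply: valP.
- by apply: val_inj; rewrite /G !SubK gf //; apply: valP.
Qed.

End TotalMaps.

(** * The domination preorder *)

Section Preorder.
Variables (V : finType) (K : complex V).

Lemma simplicial_total (F : vertex K -> vertex K) : simplicial F ->
  exists2 f : V -> V, forall s, s \in simplices K -> f @: s \in simplices K
    & forall x, f (val x) = val (F x).
Proof.
(* The value off the vertices is immaterial, since simplices contain only vertices. *)
move=> Fs; pose f x := if insub x is Some u then val (F u) else x.
have fE (x : vertex K) : f (val x) = val (F x) by rewrite /f valK.
exists f => // s sK.
have /val_imsetE[t st] : s \subset vertices K.
  by apply/subsetP => x; apply: mem_vertices.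
rewrite st -imset_comp (eq_imset (g := fun x => val (F x))) //.
by apply: Fs; rewrite -st.
Qed.

Lemma simplicial_iso_total (F : vertex K -> vertex K) : simplicial_iso F ->
  exists f g : V -> V,
    [/\ forall s, s \in simplices K -> f @: s \in simplices K,
        forall s, s \in simplices K -> g @: s \in simplices K,
        {in vertices K, cancel f g}, {in vertices K, cancel g f}
      & forall x, f (val x) = val (F x)].
Proof.
case=> /simplicial_total[f fK fE] [G [/simplicial_total[g gK gE] FG GF]].
exists f, g; split=> // x xK.
- by rewrite -[x](SubK (vertex K) xK) fE gE FG.
- by rewrite -[x](SubK (vertex K) xK) gE fE GF.
Qed.

(** Vacuously true when [v] is not a vertex, which is why later lemmas ask for
    [v \in vertices K]. *)
Definition below (v w : V) : bool :=
  [forall s in simplices K, (v \in s) ==> (w |: s \in simplices K)].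

Lemma belowP v w :
  reflect (forall s, s \in simplices K -> v \in s -> w |: s \in simplices K)
          (below v w).
Proof.
apply: (iffP forall_inP) => [vw s sK vs|vw s sK].
  by move/implyP: (vw s sK); apply.
by apply/implyP; apply: vw.
Qed.

Lemma below_refl v : below v v.
Proof. by apply/belowP => s sK vs; rewrite setUC (setUidPl _) ?sub1set. Qed.

Lemma below_vertex v w : v \in vertices K -> below v w -> w \in vertices K.
Proof.
rewrite inE => vK /belowP/(_ _ vK (set11 v)) /mem_vertices; apply.
exact: setU11.
Qed.

Definition maximal_through (v : V) : {set {set V}} :=
  [set s in maximal_simplices K | v \in s].

Lemma maximal_simplexP s :
  reflect (s \in simplices K /\
           forall t : {set V}, t \in simplices K -> s \subset t -> t = s)
          (s \in maximal_simplices K).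
Proof.
by rewrite inE; apply: (iffP maxsetP) => -[sK sm]; split=> // t; apply: sm.
Qed.

Lemma sub_maximal_simplex s : s \in simplices K ->
  exists2 m, m \in maximal_simplices K & s \subset m.
Proof.
by move/(maxset_exists (P := fun t => t \in simplices K)) => [m mm sm]; exists m;
  rewrite ?inE.
Qed.

Lemma below_maximal v w : below v w = (maximal_through v \subset maximal_through w).
Proof.
apply/belowP/subsetP => [vw s|vw s sK vs].
  rewrite !inE => /andP[sm vs]; rewrite sm /=.
  have /maximal_simplexP[sK smax] : s \in maximal_simplices K by rewrite inE.
  by rewrite -(smax _ (vw s sK vs) (subsetUr _ _)) setU11.
have [m mm sm] := sub_maximal_simplex sK.
have : m \in maximal_through w.
  by apply: vw; rewrite inE mm (subsetP sm).
rewrite inE => /andP[/maximal_simplexP[mK _] wm].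
apply: (simplex_sub mK); first by rewrite subUset sub1set wm.
by apply/set0Pn; exists w; rewrite setU11.
Qed.

Lemma below_trans : transitive below.
Proof. by move=> w v u; rewrite !below_maximal; apply: subset_trans. Qed.

(** A maximal simplex containing [s] contains everything above a point of [s], hence [t] as well. *)
Lemma below_setU (s t : {set V}) : s \in simplices K ->
  (forall y, y \in t -> exists2 x, x \in s & below x y) -> s :|: t \in simplices K.
Proof.
move=> sK st; have [m mm sm] := sub_maximal_simplex sK.
have /maximal_simplexP[mK _] := mm.
apply: (simplex_sub mK).
  rewrite subUset sm; apply/subsetP => y /st[x xs].
  rewrite below_maximal => /subsetP/(_ m).
  by rewrite !in_set => /(_ _)/andP[]//; move: mm; rewrite inE => ->; apply: (subsetP sm).
have /set0Pn[x xs] := simplex_neq0 sK.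
by apply/set0Pn; exists x; rewrite inE xs.
Qed.

Lemma below_imset (s : {set V}) (r : V -> V) : s \in simplices K ->
  {in s, forall x, below x (r x)} -> r @: s \in simplices K.
Proof.
move=> sK sr; have /set0Pn[x xs] := simplex_neq0 sK.
apply: simplex_sub (subsetUr s _) _; last by apply/set0Pn; exists (r x); rewrite imset_f.
by apply: below_setU => // _ /imsetP[y ys ->]; exists y; rewrite ?sr.
Qed.

Lemma below_morph (f g : V -> V) v w :
    (forall s, s \in simplices K -> f @: s \in simplices K) ->
    (forall s, s \in simplices K -> g @: s \in simplices K) ->
    {in vertices K, cancel f g} -> {in vertices K, cancel g f} ->
  v \in vertices K -> below v w -> below (f v) (f w).
Proof.
move=> fK gK fg gf vK /belowP vw; apply/belowP => s sK fvs.
have vgs : v \in g @: s by rewrite -(fg v vK) imset_f.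
(* Pull [s] back by [g], enlarge by [w], push forward by [f]. *)
have := fK _ (vw _ (gK s sK) vgs).
rewrite imsetU1 -imset_comp (eq_in_imset (g := id)) ?imset_id // => x xs /=.
by rewrite gf // (mem_vertices sK xs).
Qed.

Lemma below_sym v w : vertex_homogeneous K -> v \in vertices K ->
  below v w -> below w v.
Proof.
move=> hK vK vw; have wK := below_vertex vK vw.
have [F /simplicial_iso_total[f [g [fK gK fg gf fE]]] Fvw] :=
  hK (Sub v vK) (Sub w wK).
have fvw : f v = w by rewrite -[v](SubK (vertex K) vK) fE Fvw SubK.
pose up x := [set u | below x u].
have finj : {in up v &, injective f}.
  move=> x y; rewrite ![_ \in up v]inE => vx vy.
  by apply: (can_in_inj fg); apply: (below_vertex vK).
have upS : f @: up v \subset up w.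
  apply/subsetP => _ /imsetP[u + ->]; rewrite !inE -fvw.
  exact: (below_morph fK gK fg gf vK).
(* Transitivity gives [up w \subset up v], and the injection [f] gives the opposite inequality of
   cardinals. *)
have : up w == up v.
  rewrite eqEcard -(card_in_imset finj) subset_leq_card // andbT.
  by apply/subsetP => u; rewrite !inE; apply: below_trans.
by move/eqP/setP/(_ v); rewrite !inE below_refl.
Qed.

(** The apex of the link is a vertex above [v]; conversely a vertex [w] above [v] is an apex, over
    the part of the link that avoids [w]. *)
Lemma dominatedP v :
  dominated K v <-> v \in vertices K /\ exists2 w, w != v & below v w.
Proof.
split=> [[vK [a [M [aM e]]]]|[vK [w wv vw]]]; split=> //.
  have eS s : (s \in cone_simplices a M) = (s \in link_simplices K v).
    by have /setP/(_ s) := congr1 (@simplices V) e.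
  have := eS [set a]; rewrite setU11 inE => /esym/and3P[_].
  rewrite inE eq_sym => av avK; exists a => //.
  apply/belowP => s sK vs; have [s0|s0] := eqVneq (s :\ v) set0.
    by rewrite -(setD1K vs) s0 setU0 setUC.
  have : s :\ v \in link_simplices K v.
    by rewrite !inE eqxx /= setD1K // sK andbT (simplex_sub sK) ?subsetDl.
  have aU : a \in s -> a |: s \in simplices K.
    by move=> xa; rewrite setUC (setUidPl _) ?sub1set.
  (* Either [s] already contains the apex, or [s :\ v] lies in the base and the cone structure adds
     the apex to it inside the link. *)
  rewrite -eS 2!in_setU => /or3P[/set1P sa|sM|/imsetP[t _ st]].
  - by apply: aU; move: (set11 a); rewrite -sa inE => /andP[].
  - have := eS (a |: s :\ v); rewrite /cone_simplices 2!in_setU imset_f // !orbT.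
    by rewrite inE => /esym/and3P[_ _]; rewrite setUCA setD1K.
  - by apply: aU; move: (setU11 a t); rewrite -st inE => /andP[].
move/belowP: vw => vw.
exists w, (full_subcomplex (link K v) (~: [set w])); split.
  by rewrite !inE sub1set !inE eqxx andbF.
apply: val_inj; apply/setP => s; rewrite /= /cone_simplices in_set 2!in_setU.
have linkU (t : {set V}) : t != set0 -> v \notin t -> v |: t \in simplices K ->
    [&& w |: t \in simplices K, v \notin w |: t & v |: (w |: t) \in simplices K].
  move=> t0 vt vtK; rewrite !inE (negPf vt) eq_sym (negPf wv) /=.
  have wvt := vw _ vtK (setU11 v t); rewrite setUCA wvt andbT.
  apply: (simplex_sub wvt); first by rewrite setUS ?subsetUr.
  by apply/set0Pn; exists w; rewrite setU11.
apply/idP/or3P => [/and3P[sK vs vsK]|].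
  have [ws|ws] := boolP (w \in s); last first.
    by apply: Or32; rewrite !inE sK vs vsK subsetC sub1set inE.
  have [s0|s0] := eqVneq (s :\ w) set0.
    by apply: Or31; rewrite -(setD1K ws) s0 setU0 inE.
  apply: Or33; rewrite -(setD1K ws) imset_f // !inE (negPf vs) andbF /=.
  rewrite (simplex_sub sK) ?subsetDl //=.
  rewrite (simplex_sub vsK) ?setUS ?subsetDl //=.
    by apply/subsetP => x; rewrite !inE => /andP[].
  by apply/set0Pn; exists v; rewrite setU11.
case=> [/set1P->|/setIdP[]|/imsetP[t /setIdP[/setIdP[tK /andP[vt vtK]] _] ->]].
- have vwK : w |: [set v] \in simplices K.
    by apply: vw; rewrite ?set11 //; move: vK; rewrite inE.
  have := mem_vertices vwK (setU11 _ _).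
  by rewrite !inE eq_sym wv setUC => ->.
- by rewrite inE.
- exact: linkU (simplex_neq0 tK) vt vtK.
Qed.

End Preorder.

(** * Collapses and class representatives *)

Section Core.
Variables (V : finType) (K : complex V).
Hypothesis hK : vertex_homogeneous K.

(** The invariant of strong collapses of [K]: a full subcomplex with a representative of every
    class. *)
Definition meets_classes (L : complex V) : Prop :=
  (forall s, (s \in simplices L) = (s \in simplices K) && (s \subset vertices L))
  /\ (forall x, x \in vertices K -> exists2 y, y \in vertices L & below K x y).

(** From [K] to [L] fullness suffices. From [L] to [K], replace the points of a simplex by
    representatives in [L], enlarge by [w] there, and restore the original points, which by
    [below_sym] lie above their representatives. *)
Lemma meets_classes_below (L : complex V) v w : meets_classes L ->
  v \in vertices L -> w \in vertices L -> below L v w = below K v w.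
Proof.
move=> [LE Lm] vL wL; apply/belowP/belowP => vw s; last first.
  by rewrite !LE => /andP[sK sL] /(vw _ sK) ->; rewrite subUset sub1set wL.
have LK x : x \in vertices L -> x \in vertices K by rewrite !inE LE => /andP[].
move=> sK vs.
pose r x := odflt x [pick y in vertices L | below K x y].
have rP x : x \in vertices K -> (r x \in vertices L) && below K x (r x).
  move=> /Lm[y yL xy]; rewrite /r; case: pickP => //= /(_ y).
  by rewrite yL xy.
(* [v] is added explicitly because [r] may choose another representative for it. *)
have rL : v |: r @: s \in simplices L.
  rewrite LE subUset sub1set vL andbC; apply/andP; split.
    by apply/subsetP => _ /imsetP[x /(mem_vertices sK)/rP/andP[rx _] ->].
  apply: (simplex_sub (s := s :|: r @: s)).
  - apply: below_setU => // _ /imsetP[x xs ->]; exists x => //.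
    by have /andP[] := rP x (mem_vertices sK xs).
  - by rewrite subUset sub1set inE vs subsetUr.
  - by apply/set0Pn; exists v; rewrite setU11.
have := vw _ rL (setU11 _ _); rewrite LE => /andP[wrK _].
apply: (simplex_sub (s := (w |: (v |: r @: s)) :|: s)).
- apply: below_setU => // x xs; have xK := mem_vertices sK xs.
  have /andP[_ xr] := rP x xK.
  exists (r x); first by rewrite !inE imset_f ?orbT.
  exact: below_sym.
- by apply/subsetP => x; rewrite !inE; case/orP => ->; rewrite ?orbT.
- by apply/set0Pn; exists w; rewrite setU11.
Qed.

Lemma meets_classes_collapse (L L0 : complex V) :
  strong_collapse L L0 -> meets_classes L -> meets_classes L0.
Proof.
elim=> // {L L0} L L0 v /dominatedP[vL [w wv vw]] _ IH Lm; apply: IH.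
have wL := below_vertex vL vw; rewrite meets_classes_below // in vw.
have [LE Lx] := Lm.
have dE : vertices (deletion L v) = vertices L :\ v.
  by apply/setP => x; rewrite !inE sub1set !inE; case: (x == v); rewrite ?andbF ?andbT ?andbb.
split=> [s|x xK]; rewrite dE.
  rewrite !inE LE -andbA; congr (_ && _).
  by apply/andP/idP => [[]//|sL]; rewrite sL (subset_trans sL) ?subsetDl.
(* If the representative is the deleted vertex [v], the vertex [w] above it takes over. *)
have [y yL xy] := Lx x xK; have [yv|yv] := eqVneq y v.
  exists w; first by rewrite in_setD1 wv.
  by apply: below_trans vw; rewrite -yv.
by exists y; rewrite // in_setD1 yv.
Qed.

Variable K0 : complex V.
Hypothesis hK0 : is_core K K0.

Lemma core_meets_classes : meets_classes K0.
Proof.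
case: hK0 => _ _ /meets_classes_collapse; apply; split=> [s|x xK].
  apply/idP/andP => [sK|[]//]; split=> //.
  by apply/subsetP => x; apply: mem_vertices.
by exists x => //; apply: below_refl.
Qed.

Lemma core_vertex x : x \in vertices K0 -> x \in vertices K.
Proof. by rewrite !inE core_meets_classes.1 => /andP[]. Qed.

(** Otherwise [v] would be dominated in [K0], whose preorder is that of [K], against minimality. *)
Lemma core_below_inj v w : v \in vertices K0 -> w \in vertices K0 ->
  below K v w -> v = w.
Proof.
case: hK0 => _ K0min _ vK0 wK0 vw; apply/eqP/negPn/negP => nvw.
apply: (K0min v); apply/dominatedP; split=> //; exists w; first by rewrite eq_sym.
by rewrite meets_classes_below //; apply: core_meets_classes.
Qed.

Definition core_retract (x : V) : V :=
  odflt x [pick y in vertices K0 | below K x y].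

Lemma core_retractP x : x \in vertices K ->
  core_retract x \in vertices K0 /\ below K x (core_retract x).
Proof.
move=> /core_meets_classes.2[y yL xy]; rewrite /core_retract.
by case: pickP => [z /andP[]//|/(_ y)]; rewrite yL xy.
Qed.

Lemma core_retract_eq x y : x \in vertices K -> y \in vertices K0 ->
  below K x y -> core_retract x = y.
Proof.
move=> xK yK0 xy; have [rK0 xr] := core_retractP xK.
by apply: core_below_inj => //; apply: below_trans xy; apply: below_sym.
Qed.

Lemma core_retract_simplex s : s \in simplices K ->
  core_retract @: s \in simplices K0.
Proof.
move=> sK; have rP x : x \in s -> _ := fun xs => core_retractP (mem_vertices sK xs).
rewrite core_meets_classes.1; apply/andP; split.
  by apply: below_imset => // x /rP[].
by apply/subsetP => _ /imsetP[x /rP[rx _] ->].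
Qed.

(** * Homogeneity of the core *)

Lemma core_homogeneous : vertex_homogeneous K0.
Proof.
move=> v w; have vK := core_vertex (valP v); have wK := core_vertex (valP w).
have [F /simplicial_iso_total[f [g [fK gK fg gf fE]]] Fvw] :=
  hK (Sub (val v) vK) (Sub (val w) wK).
have fvw : f (val v) = val w by rewrite -[val v](SubK (vertex K) vK) fE Fvw SubK.
have simp h : (forall s, s \in simplices K -> h @: s \in simplices K) ->
    forall s, s \in simplices K0 -> (core_retract \o h) @: s \in simplices K0.
  move=> hs s; rewrite core_meets_classes.1 => /andP[sK _].
  by rewrite imset_comp core_retract_simplex ?hs.
have canc h k : (forall s, s \in simplices K -> h @: s \in simplices K) ->
    (forall s, s \in simplices K -> k @: s \in simplices K) ->
    {in vertices K, cancel h k} -> {in vertices K, cancel k h} ->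
    {in vertices K0, cancel (core_retract \o h) (core_retract \o k)}.
  move=> hs ks hk kh x xK0 /=; have xK := core_vertex xK0.
  have hxK : h x \in vertices K.
    by rewrite inE -imset_set1 hs //; move: xK; rewrite inE.
  have [rK0 hxr] := core_retractP hxK; have rK := core_vertex rK0.
  apply: core_retract_eq => //.
    by rewrite inE -imset_set1 ks //; move: rK; rewrite inE.
  (* The retract of [h x] is equivalent to [h x], so [k] sends it to a vertex equivalent to [x],
     which retracts to [x]. *)
  rewrite -[X in below _ _ X](hk x xK).
  exact: (below_morph ks hs kh hk rK (below_sym hK hxK hxr)).
have [G Giso GE] := total_maps_iso (simp f fK) (simp g gK)
  (canc f g fK gK fg gf) (canc g f gK fK gf fg).
exists G => //; apply: val_inj; rewrite GE /= fvw.
by apply: core_retract_eq wK (valP w) (below_refl _ _).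
Qed.

(** * The second nerve *)

Lemma maximal_through_inj v w : v \in vertices K0 -> w \in vertices K0 ->
  maximal_through K v = maximal_through K w -> v = w.
Proof. by move=> vK wK e; apply: core_below_inj; rewrite ?below_maximal ?e. Qed.

Lemma maximal_through_nerve v : v \in vertices K ->
  maximal_through K v \in simplices (nerve K).
Proof.
rewrite inE => /sub_maximal_simplex[m mm]; rewrite sub1set => vm.
rewrite inE; apply/and3P; split.
- by apply/set0Pn; exists m; rewrite in_set mm.
- by apply/subsetP => s /setIdP[].
- by apply/set0Pn; exists v; apply/bigcapP => s /setIdP[].
Qed.

Lemma nerve_sub_maximal_through X : X \in simplices (nerve K) ->
  exists2 v, v \in vertices K & X \subset maximal_through K v.
Proof.
rewrite inE => /and3P[/set0Pn[s sX] XK /set0Pn[v /bigcapP vX]]; exists v.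
  have /maximal_simplexP[sK _] := subsetP XK s sX.
  exact: mem_vertices sK (vX s sX).
by apply/subsetP => t tX; rewrite in_set (subsetP XK) ?vX.
Qed.

(** A common point [v] of the members of a nerve simplex puts it inside [maximal_through K v], and
    [below_sym] makes every inclusion between such sets an equality. *)
Lemma maximal_nerveP X :
  reflect (exists2 v, v \in vertices K0 & X = maximal_through K v)
          (X \in maximal_simplices (nerve K)).
Proof.
apply: (iffP (maximal_simplexP _ _)) => [[XN Xmax]|[v /core_vertex vK ->]].
  have [v vK Xv] := nerve_sub_maximal_through XN.
  have [rK0 vr] := core_retractP vK; exists (core_retract v) => //.
  apply/esym/Xmax; first by apply/maximal_through_nerve/core_vertex.
  by apply: subset_trans Xv _; rewrite -below_maximal.
split=> [|Y YN vY]; first exact: maximal_through_nerve.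
have [w wK Yw] := nerve_sub_maximal_through YN.
have vw : below K v w by rewrite below_maximal (subset_trans vY).
apply/eqP; rewrite eqEsubset vY andbT (subset_trans Yw) // -below_maximal.
exact: below_sym.
Qed.

(** The isomorphism is [maximal_through K]: vertices span a simplex exactly when a maximal simplex
    [m] contains them all, that is, when [m] is common to their images. *)
Lemma core_iso_nerve2 : isomorphic K0 (nerve (nerve K)).
Proof.
(* The empty core is treated apart, because the inverse map [g] needs a default value [v0]. *)
have [v0|no_v] := pickP (mem (vertices K0)); last first.
  have emp s : s \notin simplices K0.
    apply/negP => sK0; have /set0Pn[x xs] := simplex_neq0 sK0.
    by have /= := no_v x; rewrite (mem_vertices sK0 xs).
  have nov (x : vertex K0) : False by have := no_v (val x); rewrite /= (valP x).
  have now (x : vertex (nerve (nerve K))) : False.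
    have := valP x; rewrite inE inE => /and3P[_ + _].
    by rewrite sub1set => /maximal_nerveP[v vK0]; have /= := no_v v; rewrite vK0.
  exists (fun x => False_rect _ (nov x)); split=> [s /simplex_neq0/set0Pn[]|].
    by move=> _ /imsetP[x _ _]; case: (nov x).
  exists (fun x => False_rect _ (now x)); split=> [s /simplex_neq0/set0Pn[]|x|x].
  - by move=> _ /imsetP[x _ _]; case: (now x).
  - by case: (nov x).
  - by case: (now x).
move=> _; pose g X := odflt v0 [pick v in vertices K0 | X == maximal_through K v].
have gE v : v \in vertices K0 -> g (maximal_through K v) = v.
  move=> vK0; rewrite /g; case: pickP => [w /andP[wK0 /eqP e]|/(_ v)] /=.
    by apply/esym/maximal_through_inj.
  by rewrite vK0 eqxx.
have fS s : s \in simplices K0 ->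
    maximal_through K @: s \in simplices (nerve (nerve K)).
  move=> sK0; rewrite inE; apply/and3P; split.
  - have /set0Pn[x xs] := simplex_neq0 sK0.
    by apply/set0Pn; exists (maximal_through K x); rewrite imset_f.
  - apply/subsetP => _ /imsetP[v vs ->]; apply/maximal_nerveP; exists v => //.
    exact: mem_vertices vs.
  - move: sK0; rewrite core_meets_classes.1 => /andP[/sub_maximal_simplex[m mm sm] _].
    apply/set0Pn; exists m; apply/bigcapP => _ /imsetP[v vs ->].
    by rewrite in_set mm (subsetP sm).
have nX T X : T \in simplices (nerve (nerve K)) -> X \in T ->
    exists2 v, v \in vertices K0 & X = maximal_through K v.
  by rewrite inE => /and3P[_ /subsetP TN _] /TN/maximal_nerveP.
have gS T : T \in simplices (nerve (nerve K)) -> g @: T \in simplices K0.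
  move=> TN; have TP := nX T _ TN; move: TN; rewrite inE.
  case/and3P=> /set0Pn[X XT] _ /set0Pn[m /bigcapP mT].
  have gT : g @: T \subset m.
    apply/subsetP => _ /imsetP[Y YT ->]; have [v vK0 Yv] := TP Y YT.
    by have := mT Y YT; rewrite Yv gE // => /setIdP[].
  have /maximal_simplexP[mK _] : m \in maximal_simplices K.
    by have := mT X XT; have [v _ ->] := TP X XT; case/setIdP.
  rewrite core_meets_classes.1 (simplex_sub mK gT) /=; last first.
    by apply/set0Pn; exists (g X); rewrite imset_f.
  by apply/subsetP => _ /imsetP[Y /TP[v vK0 ->] ->]; rewrite gE.
have [|F Fiso _] := total_maps_iso fS gS gE; last by exists F.
move=> X; rewrite inE => /nX/(_ (set11 X))[v vK0 ->].
by rewrite gE.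
Qed.

End Core.

Theorem theorem6p8 (V : finType) (K : complex V) (hK : vertex_homogeneous K)
    (K0 : complex V) (hK0 : is_core K K0) :
  vertex_homogeneous K0 /\ isomorphic K0 (nerve (nerve K)).
Proof.
by split; [apply: core_homogeneous hK0 | apply: core_iso_nerve2 hK0].
Qed.
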